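(* Let $(X,\nu)$ be a standard Borel space with a non-atomic probability measure $\nu$ and let $k>0$. The measures $\hat P_{\alpha,k}$ converge weakly to the gamma measure $P_\Gamma=P_\Gamma(\nu)$ when $\alpha\to0$.
   Context: $D^+$ is the cone of finite positive discrete measures on $X$, with the $\sigma$-algebra generated by $\eta\mapsto\eta(A)$, $A\subset X$ Borel. For $\alpha\in(0,1)$, $P_\alpha$ is the law on $D^+$ of the standard $\alpha$-stable process on $(X,\nu)$ (Lévy measure $\frac{\alpha}{\Gamma(1-\alpha)}s^{-\alpha-1}ds$, $s>0$), characterized by $\mathbb{E}_\alpha\left[\exp\left(-\int_Xa\,d\eta\right)\right]=\exp\left(-\int_Xa(x)^\alpha\,d\nu(x)\right)$ for measurable $a:X\to\mathbb{R}_+$ with $\int_Xa^\alpha\,d\nu<\infty$. Let $\gamma=k/\alpha^{1/\alpha}$, and let $P_{\alpha,k}$ be the measure given by $$\frac{dP_{\alpha,k}}{dP_\alpha}(\eta)=\frac{\exp(-\gamma\,\eta(X))}{\mathbb{E}_\alpha[\exp(-\gamma\,\eta(X))]}=e^{\gamma^\alpha}e^{-\gamma\,\eta(X)}.$$ $\hat P_{\alpha,k}$ is the law of the process $\gamma\cdot\eta$, where $\eta$ has law $P_{\alpha,k}$. The gamma measure $P_\Gamma$ is the law on $D^+$ determined by $\mathbb{E}_\Gamma\left[\exp\left(-\int_X a\,d\eta\right)\right]=\exp\left(-\int_X\log(1+a)\,d\nu\right)$ for every non-negative bounded Borel $a$. Weak convergence of laws of random measures on $X$ is understood as convergence of Laplace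 transforms $\mathbb{E}\left[\exp(-\int_Xa\,d\eta)\right]$ for every non-negative bounded Borel function $a$ on $X$ (equivalently, weak convergence of the joint distributions of $(\eta(A_1),\ldots,\eta(A_n))$ for all Borel $A_1,\ldots,A_n\subset X$). *)

(* Defs.v *)
(* Library: MathComp-Analysis. *)
From HB Require Import structures.
From mathcomp Require Import all_boot all_order all_algebra.
From mathcomp Require Import all_classical all_reals all_analysis.
From mathcomp Require Import measurable_realfun.

Set Implicit Arguments.
Unset Strict Implicit.
Unset Printing Implicit Defensive.
Import Order.TTheory GRing.Theory Num.Theory.
Import numFieldNormedType.Exports.

Local Open Scope classical_set_scope.
Local Open Scope ring_scope.
Local Open Scope ereal_scope.

Section spaces.
Context (R : realType) d (X : measurableType d).

(* X is isomorphic, as a measurable space, to a complete separable metric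
   space with its Borel sigma-algebra. *)
Definition standard_borel :=
  exists (T : metricType R) (f : X -> T),
    [/\ forall F : set_system T, ProperFilter F -> cauchy F -> (exists l : T, F --> l),
        exists2 S : set T, countable S & dense S,
        bijective f &
        forall A : set X, measurable A <-> <<s (@open T) >> (f @` A)].

Definition nonatomic (nu : {measure set X -> \bar R}) :=
  forall A, measurable A -> 0 < nu A ->
    exists B, [/\ measurable B, B `<=` A & 0 < nu B < nu A].

End spaces.

Section discrete_measures.
Context d (X : measurableType d) (R : realType).

(* The weights may vanish, so finite sums and the zero measure are included.
   The equality is between functions on all subsets of X: a library measure
   also takes (otherwise unconstrained) values on non-measurable sets, and a
   discrete measure has a canonical extension to them. *)
Definition is_discrete (m : set X -> \bar R) :=
  exists (z : nat -> {nonneg R}) (x : nat -> X),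
    m = mseries (fun i => mscale (z i) \d_(x i)) 0.

Record Dplus := DPlus {
  Dplus_measure :> {finite_measure set X -> \bar R} ;
  DplusP : is_discrete Dplus_measure }.

Lemma is_discrete_mscale (c : {nonneg R}) (m : {measure set X -> \bar R}) :
  is_discrete m -> is_discrete (mscale c m).
Proof.
move=> [z [x mE]]; exists (fun i => NngNum (mulr_ge0 (ge0 c) (ge0 (z i)))), x.
apply/funext => A; rewrite /mscale mE /mseries ereal_series.
rewrite -nneseriesZl; last first.
  by move=> i _; rewrite /mscale mule_ge0 // lee_fin.
rewrite ereal_series; apply: eq_eseriesr => i _ /=.
by rewrite /mscale muleA -EFinM.
Qed.

Definition scale_fun (c : {nonneg R}) (eta : Dplus) : set X -> \bar R :=
  mscale c eta.

HB.instance Definition _ c eta := Measure.on (scale_fun c eta).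

Let scale_fin c eta : fin_num_fun (scale_fun c eta).
Proof.
by move=> A mA; rewrite /scale_fun /mscale fin_numM// fin_num_measure.
Qed.

HB.instance Definition _ c eta :=
  Measure_isFinite.Build _ _ _ (scale_fun c eta) (@scale_fin c eta).

Definition Dplus_scale (c : {nonneg R}) (eta : Dplus) : Dplus :=
  DPlus (is_discrete_mscale c (DplusP eta)).

Let mzero_discrete : is_discrete (@mzero d X R).
Proof.
exists (fun=> NngNum (lexx 0%R)), (fun=> point).
apply/funext => A; rewrite /mseries /mzero eseries0// => i _ _.
by rewrite /= /mscale mul0e.
Qed.

HB.instance Definition _ := gen_eqMixin Dplus.
HB.instance Definition _ := gen_choiceMixin Dplus.
HB.instance Definition _ :=
  isPointed.Build Dplus (@DPlus mzero mzero_discrete).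

Definition Dplus_evals : set_system Dplus :=
  \bigcup_(A in @measurable _ X)
    preimage_set_system setT (fun eta : Dplus => eta A) measurable.

Definition Dplus_measurable : set_system Dplus := <<s Dplus_evals >>.

HB.instance Definition _ := @isMeasurable.Build (sigma_display Dplus_evals)
  Dplus Dplus_measurable (@sigma_algebra0 _ setT Dplus_evals)
  (@sigma_algebraC _ Dplus_evals) (@sigma_algebra_bigcup _ setT Dplus_evals).

Lemma measurable_Dplus_eval (A : set X) : measurable A ->
  measurable_fun [set: Dplus] (fun eta : Dplus => eta A).
Proof.
move=> mA _ B mB; apply: sub_gen_smallest.
by exists A => //; exists B.
Qed.

Lemma measurable_Dplus_scale (c : {nonneg R}) :
  measurable_fun [set: Dplus] (Dplus_scale c).
Proof.
apply: (measurability Dplus_evals) => //= _ [_ [A mA [B mB <-]] <-].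
rewrite setTI.
have := @measurable_funeM _ _ _ _ _ c%:num%:E (measurable_Dplus_eval mA).
by move=> /(_ measurableT B mB); rewrite !setTI.
Qed.

HB.instance Definition _ (c : {nonneg R}) :=
  isMeasurableFun.Build _ _ _ _ (Dplus_scale c) (measurable_Dplus_scale c).

Definition total_mass (eta : Dplus) : R := fine (eta setT).

Lemma measurable_total_mass : measurable_fun [set: Dplus] total_mass.
Proof.
by apply: measurableT_comp => //; exact: measurable_Dplus_eval.
Qed.

Lemma total_mass_ge0 eta : (0 <= total_mass eta)%R.
Proof. exact: fine_ge0. Qed.

End discrete_measures.

Section laws.
Context d (X : measurableType d) (R : realType).
Implicit Types (P : probability (Dplus X R) R) (a : X -> R).

(* The inner integral may be +oo, in which case the integrand is
   expeR -oo = 0. *)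
Definition laplace P a : \bar R :=
  \int[P]_eta expeR (- \int[eta]_x (a x)%:E).

(* The alpha-stable law on Dplus is specified by its Laplace functional, which
   determines it uniquely; a may be unbounded. *)
Definition is_stable_law (nu : probability X R) (alpha : R) P :=
  forall a, measurable_fun setT a -> (forall x, 0 <= a x)%R ->
    \int[nu]_x (a x `^ alpha)%:E < +oo ->
    laplace P a = expeR (- \int[nu]_x (a x `^ alpha)%:E).

Definition is_gamma_law (nu : probability X R) P :=
  forall a, measurable_fun setT a -> (forall x, 0 <= a x)%R ->
    (exists M : R, forall x, a x <= M)%R ->
    laplace P a = expeR (- \int[nu]_x (ln (1 + a x))%:E).

Definition weak_cvg (I : Type) (F : set_system I)
    (Q : I -> probability (Dplus X R) R) P :=
  forall a, measurable_fun setT a -> (forall x, 0 <= a x)%R ->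
    (exists M : R, forall x, a x <= M)%R ->
    laplace (Q i) a @[i --> F] --> laplace P a.

Section tilt.
Variables (c : {nonneg R}) (P : probability (Dplus X R) R).

Let w (eta : Dplus X R) : R := expR (- (c%:num * total_mass eta)).

(* Exponential change of measure: the law with density
   exp(- c eta(X)) / E_P[exp(- c eta(X))] with respect to P. *)
Definition tilt_density (eta : Dplus X R) : \bar R :=
  (expR (- (c%:num * total_mass eta))
   / fine 'E_P[fun xi => expR (- (c%:num * total_mass xi))])%:E.

Definition tilt (B : set (Dplus X R)) : \bar R :=
  \int[P]_(eta in B) tilt_density eta.

Let mw : measurable_fun setT w.
Proof.
apply: measurableT_comp => //; apply: measurableT_comp => //.
exact: measurable_funM (measurable_cst _) (@measurable_total_mass _ X R).
Qed.

Let E_ge0 : (0 <= fine 'E_P[w])%R.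
Proof.
by apply: fine_ge0; rewrite unlock; apply: integral_ge0 => x _;
  rewrite lee_fin expR_ge0.
Qed.

Let mdens : measurable_fun setT tilt_density.
Proof. by apply/measurable_EFinP; exact: measurable_funM. Qed.

Let dens_ge0 eta : 0 <= tilt_density eta.
Proof. by rewrite lee_fin divr_ge0// expR_ge0. Qed.

Let tilt0 : tilt set0 = 0.
Proof. exact: integral_set0. Qed.

Let tilt_ge0 B : 0 <= tilt B.
Proof. by apply: integral_ge0 => eta _; exact: dens_ge0. Qed.

Let tilt_sigma_additive : semi_sigma_additive tilt.
Proof.
move=> F mF tF mUF; rewrite /tilt ge0_integral_bigcup//; last first.
  exact: measurable_funTS.
by apply: is_cvg_ereal_nneg_natsum_cond => n _ _; exact: tilt_ge0.
Qed.

HB.instance Definition _ := isMeasure.Build _ _ _ tilt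
  tilt0 tilt_ge0 tilt_sigma_additive.

Let E_gt0 : 0 < 'E_P[w].
Proof.
rewrite unlock lt0e integral_ge0 ?andbT//; last first.
  by move=> x _; rewrite lee_fin expR_ge0.
apply/eqP => E0.
have mE : measurable_fun setT (EFin \o w) by exact/measurable_EFinP.
have : \int[P]_x `|(EFin \o w) x| = 0.
  by rewrite -[RHS]E0; apply: eq_integral => x _;
    rewrite gee0_abs// lee_fin expR_ge0.
move=> /(ae_eq_integral_abs P measurableT mE).1 [N [mN N0 sub]].
have NT : N = setT.
  rewrite -subTset => x _; apply: sub => /= /(_ Logic.I) /eqP.
  by rewrite eqe; apply/negP; rewrite gt_eqF// expR_gt0.
by move: N0; rewrite NT /= probability_setT => /eqP; rewrite onee_eq0.
Qed.

Let E_fin : 'E_P[w] \is a fin_num.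
Proof.
rewrite ge0_fin_numE ?(ltW E_gt0)// unlock.
apply: (@le_lt_trans _ _ (\int[P]_x (cst 1 x))).
  apply: ge0_le_integral => //.
  - by move=> x _; rewrite lee_fin expR_ge0.
  - exact/measurable_EFinP.
  - move=> x _; rewrite lee_fin -expR0 ler_expR oppr_le0.
    by rewrite mulr_ge0// total_mass_ge0.
by rewrite integral_cst//= mul1e probability_setT ltry.
Qed.

Let tilt_setT : tilt setT = 1.
Proof.
rewrite /tilt /tilt_density.
under eq_integral do rewrite EFinM.
have w0 x : setT x -> 0 <= (w x)%:E by move=> _; rewrite lee_fin expR_ge0.
have mE : measurable_fun setT (EFin \o w) by exact/measurable_EFinP.
rewrite (ge0_integralZr _ measurableT mE)//; last by rewrite lee_fin invr_ge0.
have -> : \int[P]_x (w x)%:E = 'E_P[w] by rewrite unlock.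
rewrite -[X in X * _](fineK E_fin) -EFinM divff// gt_eqF// fine_gt0//.
by rewrite E_gt0/= -ge0_fin_numE// ltW.
Qed.

HB.instance Definition _ :=
  @Measure_isProbability.Build _ _ R tilt tilt_setT.

End tilt.

Section scaled_tilt.
Variables (k : {posnum R}) (alpha : R).

Let gamma_ge0 : (0 <= k%:num / alpha `^ alpha^-1)%R.
Proof. by rewrite divr_ge0// powR_ge0. Qed.

(* For alpha outside ]0, 1[ the value of gamma_ is irrelevant. *)
Definition gamma_ : {nonneg R} := NngNum gamma_ge0.

(* If P is the stable law P_alpha, then tilt gamma_ P is P_{alpha,k}, and
   P_hat P is the law of gamma_ * eta under it. *)
Definition P_hat (P : probability (Dplus X R) R) : probability (Dplus X R) R :=
  distribution (tilt gamma_ P) (Dplus_scale gamma_).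

End scaled_tilt.

End laws.

(* Main.v *)
Require Import Defs.
From mathcomp Require Import all_boot all_order all_algebra.
From mathcomp Require Import all_classical all_reals all_analysis.
From mathcomp Require Import measurable_realfun.
From mathcomp Require Import ring lra.
Import Order.TTheory GRing.Theory Num.Theory.
Import numFieldNormedType.Exports.
Local Open Scope classical_set_scope.
Local Open Scope ring_scope.

(** Everything reduces to an explicit formula for the Laplace functional of
    the rescaled tilted stable law. Write $c = k / alpha^(1/alpha)$ for the
    tilting parameter. Tilting by $exp (- c eta(X))$ shifts the test function
    by $c$ and divides by the Laplace functional at the constant $c$
    (laplace_tilt), and multiplying the random measure by $c$ multiplies the
    test function by $c$ (laplace_scale). The functional of the new law at
    $a$ is therefore the quotient of the stable functionals at $c (1 + a)$
    and at $c$. Since $c^alpha = k^alpha / alpha$, the stable formula turns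
    this quotient into
    $exp (- k^alpha \int ((1 + a)^alpha - 1) / alpha dnu)$ (laplace_P_hat).

    As $alpha$ tends to 0, $k^alpha$ tends to 1 and
    $((1 + a)^alpha - 1) / alpha$ tends to $ln (1 + a)$, which gives the
    gamma functional. The limit passes under the integral by a squeeze: for
    $y = 1 + a$ with $0 <= a <= M$ and $alpha > 0$,
    $ln y <= (y^alpha - 1) / alpha <= y^alpha ln y <= (1 + M)^alpha ln y$,
    so the integral is squeezed between $\int ln (1 + a) dnu$ and
    $(1 + M)^alpha$ times it (box_cox_integral_bounds). *)

(** * Measurability and integration against a density *)

Lemma measurable_expeR (R : realType) : measurable_fun [set: \bar R] (@expeR R).
Proof.
have -> : @expeR R = fun x => if x == +oo%E then +oo%E
    else if x == -oo%E then 0%E else (expR (fine x))%:E.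
  by apply/funext; case.
have meq (y : \bar R) : measurable_fun [set: \bar R] (fun x => x == y).
  apply: (measurable_fun_bool true); rewrite setTI.
  rewrite (_ : _ @^-1` _ = [set y])//.
  by apply/seteqP; split => [x /eqP|x /= ->]//; rewrite eqxx.
apply: measurable_fun_ifT => //; apply: measurable_fun_ifT => //.
by apply/measurable_EFinP; exact: measurableT_comp.
Qed.

Section density.
Import HBNNSimple.

(** The hypothesis is the formula for indicator functions; it extends to simple
    functions by linearity and to nonnegative functions by monotone
    convergence. *)
Lemma ge0_integral_density d (T : measurableType d) (R : realType)
    (mu m : {measure set T -> \bar R}) (g : T -> R) (f : T -> \bar R) :
  measurable_fun setT g -> (forall x, 0 <= g x) ->
  (forall A, measurable A -> m A = \int[mu]_(x in A) (g x)%:E)%E ->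
  measurable_fun setT f -> (forall x, 0 <= f x)%E ->
  (\int[m]_x f x = \int[mu]_x (f x * (g x)%:E))%E.
Proof.
move=> mg g0 mE mf f0; pose h := nnsfun_approx measurableT mf.
have mEg : measurable_fun setT (EFin \o g) by exact/measurable_EFinP.
have h_cvg x : (EFin \o h^~ x) n @[n --> \oo] --> f x.
  exact: cvg_nnsfun_approx.
have h_nd x : {homo (h^~ x) : n m / (n <= m)%N >-> n <= m}.
  by move=> n p np; exact/lefP/nd_nnsfun_approx.
have mh n : measurable_fun setT (EFin \o h n) by exact/measurable_EFinP.
have -> : (\int[m]_x f x =
    limn (fun n => \int[m]_x (h n x)%:E))%E.
  rewrite -monotone_convergence//.
  - by apply: eq_integral => x _; apply/esym/cvg_lim => //; exact: h_cvg.
  - by move=> n x _; rewrite lee_fin.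
  - by move=> x _ n p np; rewrite lee_fin h_nd.
have -> : (\int[mu]_x (f x * (g x)%:E) =
    limn (fun n => \int[mu]_x ((h n x)%:E * (g x)%:E)))%E.
  rewrite -monotone_convergence//.
  - apply: eq_integral => x _; apply/esym/cvg_lim => //.
    by apply: cvgeZr => //; exact: h_cvg.
  - by move=> n; exact: (emeasurable_funM (mh n) mEg).
  - by move=> n x _; rewrite mule_ge0 ?lee_fin.
  - by move=> x _ n p np; rewrite lee_wpmul2r ?lee_fin ?h_nd.
apply: congr_lim; apply/funext => n /=.
rewrite integralT_nnsfun sintegralE.
under [RHS]eq_integral.
  move=> x _; rewrite (fimfunE (h n) x) -fsumEFin// ge0_mule_fsuml; last first.
    by move=> r; exact: nnfun_muleindic_ge0.
  over.
rewrite ge0_integral_fsum//; last 2 first.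
- move=> r; apply: emeasurable_funM => //.
  exact/measurable_EFinP/measurable_funM.
- move=> r x _; apply: mule_ge0; first exact: nnfun_muleindic_ge0.
  by rewrite lee_fin.
apply: eq_fsbigr => r rh.
rewrite mE//.
under [RHS]eq_integral do rewrite EFinM -muleA.
rewrite ge0_integralZl//.
- congr (_ * _)%E; rewrite integral_mkcond; apply: eq_integral => x _.
  by rewrite muleC epatch_indic.
- by apply: emeasurable_funM => //; exact/measurable_EFinP.
- by move=> x _; rewrite mule_ge0 ?lee_fin.
- by move: rh; rewrite inE => -[t _ <-]; rewrite lee_fin.
Qed.

End density.

Lemma ge0_bounded_integral_lty d (X : measurableType d) (R : realType)
    (nu : probability X R) (f : X -> R) (M : R) :
  measurable_fun setT f -> (forall x, 0 <= f x) -> (forall x, f x <= M) ->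
  (\int[nu]_x (f x)%:E < +oo)%E.
Proof.
move=> mf f0 fM; apply: (@le_lt_trans _ _ (\int[nu]_x (cst M%:E x)))%E.
  apply: ge0_le_integral => //=.
  - by move=> x _; rewrite lee_fin.
  - exact/measurable_EFinP.
  - by move=> x _; rewrite lee_fin.
by rewrite integral_cst//= probability_setT mule1 ltry.
Qed.

(** * Laplace functionals of scaled and tilted laws *)

Section laplace_functional.
Context {d} {X : measurableType d} {R : realType}.
Implicit Types (a : X -> R) (P : probability (Dplus X R) R) (c : {nonneg R}).

(** The evaluations generate the sigma-algebra of the space of discrete measures,
    so the tautological family of measures indexed by that space is a kernel,
    and integrals against a kernel depend measurably on the parameter. *)
Lemma measurable_expeR_integral a :
  measurable_fun setT a -> (forall x, 0 <= a x) ->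
  measurable_fun [set: Dplus X R]
    (fun eta : Dplus X R => expeR (- \int[eta]_x (a x)%:E))%E.
Proof.
move=> ma a0; apply: measurableT_comp; first exact: measurable_expeR.
apply: measurableT_comp => //.
apply: (@measurable_fun_integral_kernel _ _ (Dplus X R) X R
  (fun eta => eta : {measure set X -> \bar R})).
- by move=> U mU; exact: measurable_Dplus_eval.
- by move=> x; rewrite lee_fin.
- exact/measurable_EFinP.
Qed.

Lemma expeR_integral_cst c (eta : Dplus X R) :
  (expeR (- \int[eta]_x (c%:num)%:E) =
   (expR (- (c%:num * total_mass eta)))%:E)%E.
Proof.
by rewrite integral_cst// /total_mass -[X in (_ * X)%E]fineK ?fin_num_measure.
Qed.

(** The normalizing constant of the exponential tilt is itself a value of the
    Laplace functional, hence explicitly known for a stable law. *)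
Lemma expectation_total_mass c P :
  ('E_P[fun eta => expR (- (c%:num * total_mass eta))])%E =
  laplace P (cst c%:num).
Proof.
by rewrite unlock; apply: eq_integral => eta _; rewrite /= expeR_integral_cst.
Qed.

Lemma laplace_scale c P a : measurable_fun setT a -> (forall x, 0 <= a x) ->
  laplace (distribution P (Dplus_scale c)) a =
  laplace P (fun x => c%:num * a x).
Proof.
move=> ma a0; rewrite /laplace ge0_integral_distribution; last 2 first.
- exact: measurable_expeR_integral.
- by move=> eta; exact: expeR_ge0.
apply: eq_integral => eta _ /=.
have mEa : measurable_fun setT (EFin \o a) by exact/measurable_EFinP.
under [in RHS]eq_integral do rewrite EFinM.
rewrite ge0_integralZl// ?lee_fin//; last by move=> x _; rewrite lee_fin.
by rewrite -ge0_integral_mscale// => x _; rewrite lee_fin.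
Qed.

(** Since $c eta(X)$ is the integral of the constant $c$ against $eta$, the
    density of the tilt multiplies $exp (- \int a deta)$ into
    $exp (- \int (c + a) deta)$, up to normalization. *)
Lemma laplace_tilt c P a : measurable_fun setT a -> (forall x, 0 <= a x) ->
  laplace (tilt c P) a =
  (laplace P (fun x => c%:num + a x)%R *
   ((fine (laplace P (cst c%:num)))^-1)%:E)%E.
Proof.
move=> ma a0; rewrite /laplace.
have mw : measurable_fun setT
    (fun eta : Dplus X R => expR (- (c%:num * total_mass eta))).
  apply: measurableT_comp => //; apply: measurableT_comp => //.
  exact: measurable_funM (measurable_cst _) (@measurable_total_mass _ X R).
have L0 : 0 <= (fine (laplace P (cst c%:num)))^-1.
  by rewrite invr_ge0 fine_ge0// integral_ge0// => eta _; exact: expeR_ge0.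
rewrite (@ge0_integral_density _ _ _ P _ (fun eta =>
   expR (- (c%:num * total_mass eta)) / fine (laplace P (cst c%:num)))).
- rewrite -ge0_integralZr//; last 2 first.
    by apply: measurable_expeR_integral => [|x]; [exact: measurable_funD|
      rewrite addr_ge0].
    by move=> eta _; exact: expeR_ge0.
  apply: eq_integral => eta _; rewrite EFinM muleA; congr (_ * _)%E.
  have mEa : measurable_fun setT (EFin \o a) by exact/measurable_EFinP.
  under [in RHS]eq_integral do rewrite EFinD.
  rewrite ge0_integralD// ?lee_fin//; last by move=> x _; rewrite lee_fin.
  rewrite oppeD ?expeRD; last first.
    by rewrite ge0_adde_def// inE integral_ge0// => x _; rewrite lee_fin.
  by rewrite muleC -expeR_integral_cst.
- exact: measurable_funM.
- by move=> eta; rewrite mulr_ge0// expR_ge0.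
- by move=> A mA; rewrite /= /tilt /tilt_density expectation_total_mass.
- exact: measurable_expeR_integral.
- by move=> eta; exact: expeR_ge0.
Qed.

End laplace_functional.

(** * The Box-Cox transform as a perturbation of the logarithm *)

Section box_cox.
Context {R : realType}.
Implicit Types (alpha y k : R).

(** The Box-Cox transform of statistics. It is the integral of $t^(alpha - 1)$
    over $[1, y]$, which interpolates to the logarithm at $alpha = 0$. *)
Definition box_cox alpha y := (y `^ alpha - 1) / alpha.

(** With $u = ln (y^alpha) = alpha ln y$ this is $1 + u <= exp u$ divided by
    $alpha$. *)
Lemma ln_le_box_cox alpha y : 0 < alpha -> 0 < y ->
  ln y <= box_cox alpha y.
Proof.
move=> alpha0 y0; rewrite ler_pdivlMr// lerBrDl mulrC -ln_powR.
by rewrite -[leRHS]lnK ?expR_ge1Dx// posrE powR_gt0.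
Qed.

(** With $u = ln (y^alpha) = alpha ln y$ this is $1 - u <= exp (- u)$
    multiplied by $exp u / alpha$. *)
Lemma box_cox_le alpha y : 0 < alpha -> 0 < y ->
  box_cox alpha y <= y `^ alpha * ln y.
Proof.
move=> alpha0 y0; rewrite ler_pdivrMr//.
have -> : y `^ alpha * ln y * alpha = y `^ alpha * (alpha * ln y).
  by rewrite -mulrA [_ * alpha]mulrC.
rewrite -ln_powR; have u0 : 0 < y `^ alpha by exact: powR_gt0.
have := expR_ge1Dx (- ln (y `^ alpha)).
rewrite -lnV// lnK ?posrE ?invr_gt0// lnV// => h.
have := ler_wpM2l (ltW u0) h; rewrite mulfV ?gt_eqF//; lra.
Qed.

Lemma cvg_powR_at_right0 y : 0 < y -> y `^ alpha @[alpha --> 0^'+] --> (1 : R).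
Proof.
move=> y0; rewrite -[X in _ --> X]expR0 -[X in expR X](mul0r (ln y)).
rewrite /powR gt_eqF//.
apply: continuous_cvg; first exact: continuous_expR.
apply: cvgMr_tmp; exact: cvg_within.
Qed.

(** The tilting parameter is chosen so that its $alpha$-th power cancels the
    factor $alpha$ in $y^alpha - 1 = alpha box_cox(alpha, y)$, up to
    $k^alpha$, which tends to 1. *)
Lemma powR_rescaling k alpha : 0 <= k -> 0 < alpha ->
  (k / alpha `^ alpha^-1) `^ alpha = k `^ alpha / alpha.
Proof.
move=> k0 alpha0.
have root : (alpha `^ alpha^-1) `^ alpha = alpha.
  by rewrite -powRrM mulVf ?gt_eqF// powRr1// ltW.
have rt0 : 0 < alpha `^ alpha^-1 by exact: powR_gt0.
apply: (mulIf (lt0r_neq0 alpha0)); rewrite divfK ?gt_eqF//.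
rewrite -[X in _ * X = _]root -powRM ?divr_ge0 ?powR_ge0//.
by rewrite divfK// gt_eqF.
Qed.

End box_cox.

(** * Convergence of the tilted stable laws *)

Section stable_to_gamma.
Context {d} {X : measurableType d} {R : realType}.
Variables (nu : probability X R) (a : X -> R) (M : R).
Hypotheses (ma : measurable_fun setT a) (a0 : forall x, 0 <= a x)
  (aM : forall x, a x <= M).

Let a1 x : 1 <= 1 + a x. Proof. by rewrite lerDl. Qed.
Let a1_gt0 x : 0 < 1 + a x. Proof. exact: lt_le_trans (a1 x). Qed.
Let m1a : measurable_fun setT (fun x => 1 + a x).
Proof. exact: measurable_funD. Qed.

Let mbc alpha : measurable_fun setT (fun x => box_cox alpha (1 + a x)).
Proof.
apply: measurable_funM => //; apply: measurable_funB => //.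
exact: (measurableT_comp (measurable_powR alpha) m1a).
Qed.

Let bc_ge0 alpha : 0 < alpha -> forall x, 0 <= box_cox alpha (1 + a x).
Proof.
move=> alpha0 x; apply: le_trans (ln_le_box_cox _ _ alpha0 (a1_gt0 x)).
exact: ln_ge0.
Qed.

Let bc_le alpha : 0 < alpha -> forall x,
  box_cox alpha (1 + a x) <= (1 + M) `^ alpha * ln (1 + a x).
Proof.
move=> alpha0 x; apply: le_trans (box_cox_le _ _ alpha0 (a1_gt0 x)) _.
have aM1 : 1 + a x <= 1 + M by rewrite lerD2l.
have M1 : 0 <= 1 + M by apply: le_trans aM1; exact: ltW.
by rewrite ler_wpM2r ?ln_ge0// ge0_ler_powR// ?nnegrE// ltW.
Qed.

Let mln : measurable_fun setT (fun x => ln (1 + a x)).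
Proof. exact: (measurableT_comp (@measurable_ln R) m1a). Qed.

Let ln_lty : (\int[nu]_x (ln (1 + a x))%:E < +oo)%E.
Proof.
apply: (@ge0_bounded_integral_lty _ _ _ _ _ M) => // x; first exact: ln_ge0.
by apply: le_trans (aM x); apply: le_ln1Dx; rewrite (lt_le_trans _ (a0 x)).
Qed.

Let ln_fin : (\int[nu]_x (ln (1 + a x))%:E)%E \is a fin_num.
Proof.
rewrite ge0_fin_numE// integral_ge0// => x _.
by rewrite lee_fin ln_ge0.
Qed.

(** These are the pointwise bounds, integrated after replacing the factor
    $(1 + a)^alpha$ of the upper one by its bound $(1 + M)^alpha$, which can
    leave the integral and tends to 1 with $alpha$ tending to 0. *)
Lemma box_cox_integral_bounds alpha : 0 < alpha ->
  (\int[nu]_x (ln (1 + a x))%:E <=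
   \int[nu]_x (box_cox alpha (1 + a x))%:E <=
   ((1 + M) `^ alpha)%:E * \int[nu]_x (ln (1 + a x))%:E)%E.
Proof.
move=> alpha0; apply/andP; split.
  apply: ge0_le_integral => //.
  - by move=> x _; rewrite lee_fin ln_ge0.
  - exact/measurable_EFinP.
  - exact/measurable_EFinP.
  - by move=> x _; rewrite lee_fin ln_le_box_cox.
rewrite -ge0_integralZl//; last 3 first.
- exact/measurable_EFinP.
- by move=> x _; rewrite lee_fin ln_ge0.
- by rewrite lee_fin powR_ge0.
apply: ge0_le_integral => //.
- by move=> x _; rewrite lee_fin bc_ge0.
- exact/measurable_EFinP.
- by apply/measurable_EFinP; exact: measurable_funM.
- by move=> x _; rewrite -EFinM lee_fin bc_le.
Qed.

(** The transform appears because subtracting the exponent at the constant $c$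
    from that at $c (1 + a)$ leaves
    $c^alpha ((1 + a)^alpha - 1) = k^alpha ((1 + a)^alpha - 1) / alpha$. *)
Lemma laplace_P_hat (k : {posnum R}) alpha P :
  0 < alpha -> is_stable_law nu alpha P ->
  laplace (P_hat k alpha P) a =
  expeR (- ((k%:num `^ alpha)%:E * \int[nu]_x (box_cox alpha (1 + a x))%:E))%E.
Proof.
move=> alpha0 hP.
set c := gamma_ k alpha.
set K := k%:num `^ alpha.
have K0 : 0 <= K by exact: powR_ge0.
have cE : c%:num `^ alpha = K / alpha by exact: powR_rescaling.
have /andP[_ I_le] := box_cox_integral_bounds _ alpha0.
have I_fin : (\int[nu]_x (box_cox alpha (1 + a x))%:E)%E \is a fin_num.
  rewrite ge0_fin_numE; last first.
    by apply: integral_ge0 => x _; rewrite lee_fin bc_ge0.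
  by rewrite (le_lt_trans I_le)// -(fineK ln_fin) -EFinM ltry.
have IE := fineK I_fin; rewrite -IE; set i := fine _ in IE *.
(* The stable exponent at $c (1 + a)$: its first term is the exponent at the
   constant $c$ and cancels against the normalizing factor. *)
have JE : (\int[nu]_x ((c%:num + c%:num * a x) `^ alpha)%:E =
    (K / alpha + K * i)%:E)%E.
  transitivity (\int[nu]_x
      ((K / alpha)%:E + K%:E * (box_cox alpha (1 + a x))%:E))%E.
    apply: eq_integral => x _; rewrite -EFinM -EFinD; congr EFin.
    have -> : c%:num + c%:num * a x = c%:num * (1 + a x) by lra.
    rewrite powRM// ?cE ?ltW// /box_cox; field; exact: lt0r_neq0.
  rewrite ge0_integralD//; last 3 first.
  - by move=> x _; rewrite lee_fin divr_ge0// ltW.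
  - by move=> x _; rewrite -EFinM lee_fin mulr_ge0// bc_ge0.
  - by apply/measurable_EFinP; exact: measurable_funM.
  rewrite integral_cst//= probability_setT mule1 ge0_integralZl//.
  - by rewrite -IE EFinD EFinM.
  - exact/measurable_EFinP.
  - by move=> x _; rewrite lee_fin bc_ge0.
have L1 : laplace P (cst c%:num) = (expR (- (K / alpha)))%:E.
  have E1 : (\int[nu]_x ((cst c%:num x) `^ alpha)%:E = (K / alpha)%:E)%E.
    under eq_integral do rewrite /= cE.
    by rewrite integral_cst//= probability_setT mule1.
  by rewrite hP// E1// ltry.
rewrite laplace_scale// laplace_tilt//; last 2 first.
- exact: measurable_funM.
- by move=> x; rewrite mulr_ge0.
rewrite L1 hP ?JE ?ltry//; last 2 first.
- by apply: measurable_funD => //; exact: measurable_funM.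
- by move=> x; rewrite addr_ge0// mulr_ge0.
rewrite /= -EFinM -expRN opprK -expRD; congr (EFin (expR _)); lra.
Qed.

Lemma cvg_laplace_P_hat (k : {posnum R}) (P : R -> probability (Dplus X R) R) :
  (forall alpha, 0 < alpha -> alpha < 1 -> is_stable_law nu alpha (P alpha)) ->
  laplace (P_hat k alpha (P alpha)) a @[alpha --> 0^'+] -->
  expeR (- \int[nu]_x (ln (1 + a x))%:E)%E.
Proof.
move=> hP; rewrite -(fineK ln_fin); set l := fine _; rewrite /=.
(* $M$ is nonnegative because $X$ is inhabited. *)
have M1 : 0 < 1 + M.
  by apply: (lt_le_trans (a1_gt0 point)); rewrite lerD2l.
have K1 : k%:num `^ alpha @[alpha --> 0^'+] --> (1 : R).
  exact: cvg_powR_at_right0.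
have B1 : (1 + M) `^ alpha @[alpha --> 0^'+] --> (1 : R).
  exact: cvg_powR_at_right0.
apply: (@squeeze_cvge _ _ _ _
  (fun alpha => (expR (- (k%:num `^ alpha * ((1 + M) `^ alpha * l))))%:E) _
  (fun alpha => (expR (- (k%:num `^ alpha * l)))%:E)).
- near=> alpha.
  have alpha0 : 0 < alpha by [].
  have alpha1 : alpha < 1 by near: alpha; exact: nbhs_right_lt.
  rewrite (laplace_P_hat _ _ _ alpha0 (hP _ alpha0 alpha1)).
  have /andP[lI Il] := box_cox_integral_bounds _ alpha0.
  have K0 : 0 <= k%:num `^ alpha by exact: powR_ge0.
  apply/andP; split;
    [rewrite -[leLHS]/(expeR _%:E)|rewrite -[leRHS]/(expeR _%:E)];
    rewrite lee_expeR EFinN leeN2 EFinM lee_wpmul2l//.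
    by rewrite EFinM fineK.
  by rewrite fineK.
- apply: cvg_EFin; first exact: nearW.
  apply: continuous_cvg; first exact: continuous_expR.
  by apply: cvgN; have := cvgM K1 (cvgM B1 (cvg_cst l)); rewrite !mul1r; exact.
- apply: cvg_EFin; first exact: nearW.
  apply: continuous_cvg; first exact: continuous_expR.
  by apply: cvgN; have := cvgM K1 (cvg_cst l); rewrite mul1r; exact.
Unshelve. all: by end_near.
Qed.

End stable_to_gamma.

Theorem theorem8 (R : realType) (d : measure_display) (X : measurableType d)
    (nu : probability X R) (hX : standard_borel R X) (hnu : nonatomic nu)
    (k : {posnum R})
    (P : R -> probability (Dplus X R) R)
    (hP : forall alpha : R, 0 < alpha -> alpha < 1 ->
            is_stable_law nu alpha (P alpha))
    (P_Gamma : probability (Dplus X R) R)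
    (hGamma : is_gamma_law nu P_Gamma) :
  weak_cvg (0 : R)^'+ (fun alpha : R => P_hat k alpha (P alpha)) P_Gamma.
Proof.
move=> a ma a0 [M aM]; rewrite hGamma//; last by exists M.
exact: cvg_laplace_P_hat aM _ _ hP.
Qed.
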